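(* The set $\mathrm{wIFS}^1$ of all attractors for weak iterated function systems acting on $[0,1]$ is an analytic subset of the hyperspace $K([0,1])$.
   Context: $K([0,1])$ is the space of all nonempty compact subsets of $[0,1]$ (with its usual metric), equipped with the Hausdorff metric. A function $s\colon[0,1]\to[0,1]$ is a weak contraction if $|s(x)-s(y)|<|x-y|$ for every pair of distinct points $x,y\in[0,1]$. A weak iterated function system on $[0,1]$ is a finite set $\{s_1,\dots,s_k\}$ of weak contractions on $[0,1]$. A set $A\in K([0,1])$ is an attractor for $\{s_1,\dots,s_k\}$ if $A=\bigcup_{i=1}^k s_i[A]$. $\mathrm{wIFS}^1$ is the set of all $A\in K([0,1])$ for which there is a weak iterated function system on $[0,1]$ having $A$ as an attractor. A subset of a Polish space is analytic if it is a continuous image of a Polish space (the empty set also being analytic). *)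

(* Defs.v *)
From HB Require Import structures.
From mathcomp Require Import all_boot all_order all_algebra.
From mathcomp Require Import all_classical all_reals all_analysis.

Set Implicit Arguments.
Unset Strict Implicit.
Unset Printing Implicit Defensive.

Import Order.TTheory GRing.Theory Num.Theory.
Import numFieldNormedType.Exports.

Local Open Scope classical_set_scope.
Local Open Scope ring_scope.

Section subtype_metric.
Context {R : realType} {X : metricType R} (A : set X).

Let dist (x y : A) : R := mdist (\val x) (\val y).

Let dist_ge0 x y : 0 <= dist x y.
Proof. exact: mdist_ge0. Qed.

Let dist_positivity x y : dist x y = 0 -> x = y.
Proof. by move=> /mdist_positivity /val_inj. Qed.

Let ballEdist (x : A) e : ball x e = [set y | dist x y < e].
Proof.
rewrite -(initial_ballE (f := (set_val : A -> X))) ballEmdist.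
by apply/seteqP; split => y.
Qed.

HB.instance Definition _ :=
  @PseudoMetric_isMetric.Build R A dist dist_ge0 dist_positivity ballEdist.

End subtype_metric.

Section hausdorff_metric.
Context {R : realType} {X : metricType R}.
Implicit Types (A B C : set X) (x y : X).

(* [inf] and [sup] are real-valued, so these are meaningful only on nonempty,
   resp. nonempty bounded, sets; compact sets are bounded by
   [compact_mdist_bounded]. *)
Definition dist_to A x : R := inf [set mdist x a | a in A].

Definition hausdorff_dist A B : R :=
  Num.max (sup [set dist_to B x | x in A]) (sup [set dist_to A y | y in B]).

Lemma dist_to_le A x a : A a -> dist_to A x <= mdist x a.
Proof.
move=> Aa; apply: ge_inf; last by exists a.
by exists 0 => _ [b _ <-]; exact: mdist_ge0.
Qed.

Lemma le_dist_to A x (r : R) :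
  A !=set0 -> (forall a, A a -> r <= mdist x a) -> r <= dist_to A x.
Proof.
move=> [a Aa] rA; apply: lb_le_inf; first by exists (mdist x a), a.
by move=> _ [b Ab <-]; exact: rA.
Qed.

Lemma dist_to_triangle A x y :
  A !=set0 -> dist_to A x <= mdist x y + dist_to A y.
Proof.
move=> A0; rewrite -lerBlDl; apply: le_dist_to => // a Aa.
by rewrite lerBlDl (le_trans (dist_to_le x Aa))// metric_triangle.
Qed.

Lemma compact_mdist_bounded A x :
  compact A -> exists M : R, forall a, A a -> mdist x a <= M.
Proof.
move=> /compact_near_coveringP cA.
have [] := cA R (pinfty_nbhs R) (fun M a => mdist x a <= M) _.
  move=> a Aa; near=> z M => /=.
  rewrite (le_trans (metric_triangle _ a _))//.
  apply: (@le_trans _ _ (mdist x a + 1)); last by near: M; apply: nbhs_pinfty_ge; rewrite num_real.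
  rewrite lerD2l ltW//; near: z.
  by have := @near_ball R X a 1 ltr01; apply: filterS => z; rewrite ballEmdist.
move=> M [_ AM]; exists (M + 1) => a Aa.
by apply: (AM (M + 1)) => //; rewrite ltrDl.
Unshelve. all: by end_near. Qed.

Lemma dist_to_le_sup A B x : compact A -> B !=set0 -> A x ->
  dist_to B x <= sup [set dist_to B z | z in A].
Proof.
move=> cA [b Bb] Ax; have [M AM] := compact_mdist_bounded b cA.
apply: sup_upper_bound; last by exists x.
split; first by exists (dist_to B x), x.
exists M => _ [a Aa <-]; rewrite (le_trans (dist_to_le _ Bb))// metric_sym.
exact: AM.
Qed.

Lemma sup_dist_to_le A B (r : R) :
  A !=set0 -> (forall a, A a -> dist_to B a <= r) ->
  sup [set dist_to B z | z in A] <= r.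
Proof.
move=> [a Aa] Ar; apply: ge_sup; first by exists (dist_to B a), a.
by move=> _ [b Ab <-]; exact: Ar.
Qed.

Lemma dist_to_le0 A x : A !=set0 -> compact A -> dist_to A x <= 0 -> A x.
Proof.
move=> A0 cA Ax0; apply: (compact_closed (@metric_hausdorff _ _) cA).
move=> U /nbhs_ballP[e /= e0 eU].
apply: contrapT => AU0; have : e <= dist_to A x.
  apply: le_dist_to => // a Aa; rewrite leNgt; apply/negP => xae.
  by apply: AU0; exists a; split => //; apply: eU; rewrite ballEmdist.
by rewrite leNgt (le_lt_trans Ax0).
Qed.

Lemma sup_dist_to_triangle A B C :
  A !=set0 -> B !=set0 -> C !=set0 -> compact A -> compact B ->
  sup [set dist_to C x | x in A] <=
  sup [set dist_to B x | x in A] + sup [set dist_to C y | y in B].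
Proof.
move=> A0 B0 C0 cA cB; apply: sup_dist_to_le => // a Aa.
apply: (@le_trans _ _ (dist_to B a + sup [set dist_to C y | y in B])); last first.
  by rewrite lerD2r dist_to_le_sup.
rewrite -lerBlDr; apply: le_dist_to => // b Bb.
rewrite lerBlDr (le_trans (dist_to_triangle a b C0))// lerD2l.
exact: dist_to_le_sup.
Qed.

End hausdorff_metric.

Record hyperspace {R : realType} (X : metricType R) := Hyperspace {
  hyperset :> set X ;
  hyperset_nonempty : hyperset !=set0 ;
  hyperset_compact : compact hyperset }.
Arguments hyperset_compact {R X} _ _ _ _.

Section hyperspace_metric.
Context {R : realType} {X : metricType R}.
Implicit Types A B C : hyperspace X.

HB.instance Definition _ := gen_eqMixin (hyperspace X).
HB.instance Definition _ := gen_choiceMixin (hyperspace X).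

Let dist A B : R := hausdorff_dist A B.

Let hyperspace_eq A B : (A : set X) = B -> A = B.
Proof.
case: A B => [A A0 cA] [B B0 cB] /= AB; subst B.
by congr Hyperspace; exact: Prop_irrelevance.
Qed.

Let distxx A : dist A A = 0.
Proof.
have [A0 cA] := (hyperset_nonempty A, hyperset_compact A).
rewrite /dist /hausdorff_dist maxxx; apply/eqP; rewrite eq_le; apply/andP; split.
  apply: sup_dist_to_le => // a Aa.
  by rewrite (le_trans (dist_to_le a Aa))// mdistxx.
have [a Aa] := A0; apply: le_trans (dist_to_le_sup cA A0 Aa).
by apply: le_dist_to => // b _; exact: mdist_ge0.
Qed.

Let dist_positivity A B : dist A B = 0 -> A = B.
Proof.
move=> AB0; have /andP[AB BA] : (sup [set dist_to B x | x in A] <= 0) &&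
    (sup [set dist_to A y | y in B] <= 0).
  by rewrite -ge_max -[leRHS]AB0.
apply: hyperspace_eq; apply/seteqP; split => x xA.
- apply: dist_to_le0 (hyperset_nonempty B) (hyperset_compact B) _.
  by apply: le_trans AB; apply: dist_to_le_sup (hyperset_compact A) _ xA;
    exact: hyperset_nonempty.
- apply: dist_to_le0 (hyperset_nonempty A) (hyperset_compact A) _.
  by apply: le_trans BA; apply: dist_to_le_sup (hyperset_compact B) _ xA;
    exact: hyperset_nonempty.
Qed.

Let dist_sym A B : dist A B = dist B A.
Proof. by rewrite /dist /hausdorff_dist maxC. Qed.

Let dist_triangle B A C : dist A C <= dist A B + dist B C.
Proof.
have [A0 cA] := (hyperset_nonempty A, hyperset_compact A).
have [B0 cB] := (hyperset_nonempty B, hyperset_compact B).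
have [C0 cC] := (hyperset_nonempty C, hyperset_compact C).
rewrite /dist {1}/hausdorff_dist ge_max; apply/andP; split.
  apply: le_trans (sup_dist_to_triangle A0 B0 C0 cA cB) _.
  by apply: lerD; rewrite le_max lexx.
apply: le_trans (sup_dist_to_triangle C0 B0 A0 cC cB) _.
by rewrite addrC; apply: lerD; rewrite le_max lexx orbT.
Qed.

HB.instance Definition _ := @isMetric.Build R (hyperspace X)
  dist distxx dist_positivity dist_sym dist_triangle.

Lemma hyperspace_mdistE A B : mdist A B = hausdorff_dist A B.
Proof. by []. Qed.

End hyperspace_metric.

Section polish_analytic.
Context (R : realType).

Definition separable (T : topologicalType) :=
  exists2 D : set T, countable D & dense D.

Definition compatible_metric (T : topologicalType) (d : T -> T -> R) :=
  [/\ forall x y, d x y = 0 <-> x = y,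
      forall x y, d x y = d y x,
      forall x y z, d x z <= d x y + d y z &
      forall x, nbhs x = filter_from [set e | 0 < e] (fun e => [set y | d x y < e])].

(* Only used for compatible metrics, so the convergence, which is in the
   topology of [T], is convergence for [d]. *)
Definition complete_metric (T : topologicalType) (d : T -> T -> R) :=
  forall u : nat -> T,
    (forall e, 0 < e -> \forall m & n \near \oo, d (u m) (u n) < e) ->
    exists l : T, u n @[n --> \oo] --> l.

Definition polish (T : topologicalType) :=
  separable T /\
  exists2 d : T -> T -> R, compatible_metric d & complete_metric d.

Definition analytic (X : topologicalType) (A : set X) :=
  A = set0 \/
  exists P : topologicalType, polish P /\
    exists2 f : P -> X, continuous f & range f = A.

End polish_analytic.

(* The metric structure of the reals is attached to [R^o]. *)
Definition unit_interval (R : realType) : set R^o := [set` `[0 : R, 1]].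
Arguments unit_interval R : clear implicits.

Definition unit_interval_metric (R : realType) : metricType R :=
  set_type (unit_interval R).

Lemma unit_interval_mdistE (R : realType) (x y : unit_interval_metric R) :
  mdist x y = `|(\val x : R) - \val y|.
Proof. by rewrite distrC. Qed.

Section weak_ifs.
Context (R : realType).
Local Notation I := (unit_interval R).
Local Notation KI := (hyperspace (unit_interval_metric R)).

Definition weak_contraction (s : I -> I) :=
  forall x y : I, x <> y ->
    `|(\val (s x) : R) - \val (s y)| < `|(\val x : R) - \val y|.

Definition weak_ifs (S : set (I -> I)) :=
  finite_set S /\ forall s, S s -> weak_contraction s.

Definition is_attractor (S : set (I -> I)) (A : KI) :=
  (A : set I) = \bigcup_(s in S) s @` A.

Definition wIFS1 : set KI :=
  [set A | exists2 S, weak_ifs S & is_attractor S A].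

End weak_ifs.

Arguments wIFS1 R : clear implicits.

(* Main.v *)
Require Import Defs.
From HB Require Import structures.
From mathcomp Require Import all_boot all_order all_algebra.
From mathcomp Require Import all_classical all_reals all_analysis.
From mathcomp Require Import lra.

(* On a compact space a contractive map has moduli: for each [n] there is [m] with
   [d (s x) (s y) <= d x y - 1/(m+1)] whenever [d x y >= 1/(n+1)]. A finite system
   together with its moduli and its values on finite nets up to finite precision
   is encoded by a sequence in a countable set. By compactness of the space of
   systems for pointwise convergence, the codes form a closed set of sequences,
   hence a Polish space. The moduli force the attractor of a coded system to be
   unique and to depend continuously on the code, so the set of attractors is a
   continuous image of the space of codes. *)

Set Implicit Arguments.
Unset Strict Implicit.
Unset Printing Implicit Defensive.

Import Order.TTheory GRing.Theory Num.Theory.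
Import numFieldNormedType.Exports.

Local Open Scope classical_set_scope.
Local Open Scope ring_scope.

(** * Consequences of compactness *)

(** Choose [u n] in [E n]. Each [E n] contains a tail of [u], hence every cluster point of [u]. *)
Lemma nested_closed_meet (T : topologicalType) (E : nat -> set T) :
  compact [set: T] -> (forall n, closed (E n)) -> (forall n, E n !=set0) ->
  (forall n, E n.+1 `<=` E n) -> \bigcap_n E n !=set0.
Proof.
move=> cT cE E0 dE.
have Emono m n : (m <= n)%N -> E n `<=` E m.
  elim: n => [|n IH]; first by rewrite leqn0 => /eqP ->.
  rewrite leq_eqVlt => /predU1P[-> //|/IH]; exact: subset_trans.
pose u n := sval (cid (E0 n)).
have Eu n : E n (u n) by rewrite /u; case: cid.
have [p [_ clp]] := cT (u @ \oo) _ filterT.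
exists p => n _; apply: (cE n) => B pB; apply: clp pB.
by exists n => // m /= /Emono; apply; exact: Eu.
Qed.

Section compact_metric.
Context {R : realType} {X : metricType R}.

Lemma cvg_mdist (T : Type) (F : set_system T) (f g : T -> X) (a b : X) :
  Filter F -> f @ F --> a -> g @ F --> b ->
  mdist (f t) (g t) @[t --> F] --> (mdist a b : R).
Proof.
move=> FF fa gb; apply/cvgrPdist_le => e e0.
have e20 : 0 < e / 2 by rewrite divr_gt0.
near=> t.
have dfa : mdist a (f t) <= e / 2.
  by near: t; exact: metricType_numDomainType.cvgr_dist_le fa _ e20.
have dgb : mdist b (g t) <= e / 2.
  by near: t; exact: metricType_numDomainType.cvgr_dist_le gb _ e20.
have := metric_triangle a (f t) b; have := metric_triangle (f t) (g t) b.
have := metric_triangle (f t) a (g t); have := metric_triangle a b (g t).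
rewrite (metric_sym (f t) a) (metric_sym (g t) b) ler_norml; lra.
Unshelve. all: by end_near. Qed.

(** One shape covers all the closed conditions below: a distance becomes a constant when its two
    maps are constant, and vanishes when they coincide. *)
Lemma closed_mdist_le (T : topologicalType) (f g h k : T -> X) (c : R) :
  continuous f -> continuous g -> continuous h -> continuous k ->
  closed [set t | mdist (f t) (g t) <= mdist (h t) (k t) + c].
Proof.
move=> cf cg ch ck.
rewrite (_ : [set _ | _] =
    (fun t => mdist (f t) (g t) - mdist (h t) (k t) : R) @^-1` [set y | y <= c]).
  apply: preimage_closed; last exact: closed_le.
  by move=> t _; apply: (@cvgB _ R); apply: cvg_mdist;
    [exact: cf|exact: cg|exact: ch|exact: ck].
by apply/seteqP; split => t /=; rewrite lerBlDl.
Qed.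

(** Compactness is applied along the filter of finite lists ordered by inclusion: on the ball of
    radius [c] about [y], every list containing [y] works. *)
Lemma finite_net (c : R) : compact [set: X] -> 0 < c ->
  exists s : seq X, forall x, exists2 y, y \in s & mdist x y < c.
Proof.
move=> /compact_near_coveringP cX c0.
pose F := filter_from setT (fun s0 : seq X => [set s : seq X | {subset s0 <= s}]).
have FF : Filter F.
  apply: filter_from_filter; first by exists [::].
  move=> s t _ _; exists (s ++ t) => // u us.
  by split => x xs; apply: us; rewrite mem_cat xs ?orbT.
have [|s _ sX] := cX _ F (fun s x => exists2 y, y \in s & mdist x y < c) FF.
  move=> y _; exists (ball y c, [set s : seq X | {subset [:: y] <= s}]) => /=.
    by split; [exact: nbhsx_ballx|exists [:: y]].
  move=> [x s] /= []; rewrite ballEmdist /= metric_sym => xy ys.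
  by exists y => //; apply: ys; rewrite mem_head.
by exists s => x; exact: (sX s).
Qed.

Lemma nonexpansive_continuous (s : X -> X) :
  (forall x y, mdist (s x) (s y) <= mdist x y) -> continuous s.
Proof.
move=> sle x; apply/metricType_numDomainType.cvgrPdist_lt => e e0; near=> y.
rewrite (le_lt_trans (sle _ _))//; near: y.
exact: (@metricType_numDomainType.cvgr_dist_lt _ _ _ _ _ id x cvg_id).
Unshelve. all: by end_near. Qed.

End compact_metric.

(** * Invariant sets of finite systems and their stability *)

Section invariant_sets.
Context {R : realType} {X : metricType R}.
Implicit Types (s t : nat -> X -> X) (k : nat).

(** The indices are [0, ..., k], so there is always at least one map and the image of a nonempty set
    is nonempty. *)
Definition union_image k s (A : set X) : set X :=
  \bigcup_(i in `I_k.+1) s i @` A.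

Definition nonexpansive k s := forall i x y,
  (i <= k)%N -> mdist (s i x) (s i y) <= mdist x y.

Lemma dist_to_lt (A : set X) (x : X) (r : R) :
  A !=set0 -> dist_to A x < r -> exists2 a, A a & mdist x a < r.
Proof.
move=> A0; apply: contraPP => nA; apply/negP; rewrite -leNgt.
apply: le_dist_to => // a Aa; rewrite leNgt; apply/negP => xa.
by apply: nA; exists a.
Qed.

Lemma dist_to_le_mdist (A B : hyperspace X) (x : X) :
  hyperset A x -> dist_to B x <= mdist A B.
Proof.
move=> Ax; rewrite hyperspace_mdistE /hausdorff_dist le_max.
by rewrite (dist_to_le_sup (hyperset_compact A) (hyperset_nonempty B) Ax).
Qed.

Lemma hyperspace_mdist_le (A B : hyperspace X) (r : R) :
  (forall x, hyperset A x -> dist_to B x <= r) ->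
  (forall x, hyperset B x -> dist_to A x <= r) ->
  mdist A B <= r.
Proof.
move=> AB BA; rewrite hyperspace_mdistE /hausdorff_dist ge_max.
by rewrite !sup_dist_to_le//; exact: hyperset_nonempty.
Qed.

(* With [h] the distance, every point of one set is within [h + eta] of the
   other; applying the maps brings it within [max r (h + eta - e) + d], which is
   below [h] unless [h <= r + d]. *)
Lemma mdist_invariant k s t (A B : hyperspace X) (r e d : R) :
  nonexpansive k s ->
  (forall i x y, (i <= k)%N -> r <= mdist x y ->
    mdist (s i x) (s i y) <= mdist x y - e) ->
  (forall i x, (i <= k)%N -> mdist (s i x) (t i x) <= d) -> d < e ->
  (A : set X) = union_image k s A -> (B : set X) = union_image k t B ->
  mdist A B <= r + d.
Proof.
move=> ns se st de Aeq Beq; rewrite leNgt; apply/negP => rdh.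
set h := mdist A B in rdh *.
(* Here [eta] is [(e - d) / 2], so that [h + eta - e + d] is [h - (e - d) / 2]. *)
pose c := Num.max (r + d) (h - (e - d) / 2).
have ch : c < h by rewrite /c gt_max rdh /=; lra.
have close i x y : (i <= k)%N -> mdist x y < h + (e - d) / 2 ->
    mdist (s i x) (t i y) <= c.
  move=> ik xy; have := metric_triangle (s i x) (s i y) (t i y).
  have := st i y ik; rewrite /c le_max; have [rxy|xyr] := leP r (mdist x y).
    by have := se _ _ _ ik rxy => ? ? ?; apply/orP; right; lra.
  by have := ns _ x y ik => ? ? ?; apply/orP; left; lra.
suff : h <= c by rewrite leNgt ch.
apply: hyperspace_mdist_le => x.
  rewrite {1}Aeq => -[i /= ik [a Aa <-]].
  have [|b Bb ab] := @dist_to_lt B a (h + (e - d) / 2) (hyperset_nonempty B).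
    by have := dist_to_le_mdist B Aa; rewrite -/h; lra.
  apply: le_trans (close i a b ik ab); apply: dist_to_le.
  by rewrite Beq; exists i => //; exists b.
rewrite {1}Beq => -[i /= ik [b Bb <-]].
have [|a Aa ab] := @dist_to_lt A b (h + (e - d) / 2) (hyperset_nonempty A).
  by have := dist_to_le_mdist A Bb; rewrite metric_sym -/h; lra.
apply: le_trans (close i a b ik _); last by rewrite metric_sym.
rewrite metric_sym; apply: dist_to_le.
by rewrite Aeq; exists i => //; exists a.
Qed.

(** The invariant set is the intersection of the decreasing iterates [E n] of the whole space under
    [union_image k s], which are closed since the maps are continuous. *)
Lemma exists_invariant k s : compact [set: X] -> [set: X] !=set0 ->
  nonexpansive k s ->
  exists A : hyperspace X, (A : set X) = union_image k s A.
Proof.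
move=> cX X0 ns.
have cs i : (i <= k)%N -> continuous (s i).
  by move=> ik; apply: nonexpansive_continuous => x y; exact: ns.
have Fclosed A : closed A -> closed (union_image k s A).
  move=> cA; apply: closed_bigcup => // i /= ik.
  apply: compact_closed; first exact: metric_hausdorff.
  apply: continuous_compact; first exact/continuous_subspaceT/cs.
  exact: subclosed_compact cA cX (@subsetT _ _).
have Fsub A B : A `<=` B -> union_image k s A `<=` union_image k s B.
  by move=> AB _ [i ik [x Ax <-]]; exists i => //; exists x => //; exact: AB.
pose E n := iter n (union_image k s) setT.
have cE n : closed (E n) by elim: n => [|n IH]; [exact: closedT|exact: Fclosed].
have dE n : E n.+1 `<=` E n by elim: n => [|n IH] //; exact: Fsub.
have E0 n : E n !=set0.
  elim: n => [//|n [x Ex]]; exists (s 0%N x); exists 0%N => //; by exists x.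
have nK := nested_closed_meet cX cE E0 dE.
have cK : compact (\bigcap_n E n).
  apply: subclosed_compact cX (@subsetT _ _).
  by apply: closed_bigI => n _; exact: cE.
exists (Hyperspace nK cK) => /=; apply/seteqP; split => x; last first.
  by move=> Fx n _; apply: dE; move: Fx; apply: Fsub => y; exact.
move=> Kx.
(* The preimages of [x] in [E n] form nested nonempty closed sets; a common point is a preimage of
   [x] lying in the intersection. *)
pose G n := E n `&` \bigcup_(i in `I_k.+1) [set y | s i y = x].
have [n|n|n y [/dE ? ?]|y Gy] := @nested_closed_meet _ G cX; last 1 first.
- have [_ [i ik yx]] := Gy 0%N I; exists i => //=; exists y => // n _.
  by have [] := Gy n I.
- apply: closedI => //; apply: closed_bigcup => // i ik.
  rewrite (_ : mkset _ = s i @^-1` [set x])//.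
  apply: preimage_closed => [y _|]; first exact: cs.
  apply: compact_closed; [exact: metric_hausdorff|exact: compact_set1].
- by have [i ik [y Ey yx]] := Kx n.+1 I; exists y; split => //; exists i.
- by split.
Qed.

End invariant_sets.

(** * Closed sets of sequences in a countable set as Polish spaces *)

Definition branch_closed (T : Type) (C : set (nat -> T)) := forall p,
  (forall n, exists2 q, C q & forall i, (i < n)%N -> p i = q i) -> C p.

(* [R] is only there for the metric. *)
Definition branches (R : realType) (T : countType) (C : set (nat -> T)) :
  Type :=
  {p : nat -> T | C p}.

Section branches.
Context {R : realType} {T : countType} {C : set (nat -> T)}.
Local Notation P := (branches R C).
Implicit Types p q : P.

HB.instance Definition _ := gen_eqMixin P.
HB.instance Definition _ := gen_choiceMixin P.

(** This is [1/(n+1)] for the first index [n] of disagreement. Adjoining [0] keeps the supremum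
    meaningful when [p] and [q] are equal. *)
Definition branches_dist p q : R :=
  sup (0 |` [set n.+1%:R^-1 | n in [set n | sval p n <> sval q n]]).

Let dist_has_sup p q :
  has_sup (0 |` [set (n.+1%:R^-1 : R) | n in [set n | sval p n <> sval q n]]).
Proof.
split; first by exists 0; left.
exists 1 => _ [->//|[n _ <-]].
by rewrite invf_le1 ?ltr0n// ler1n.
Qed.

Lemma branches_dist_le p q (e : R) : 0 <= e ->
  branches_dist p q <= e <-> forall n, sval p n <> sval q n -> n.+1%:R^-1 <= e.
Proof.
move=> e0; split=> [pqe n npq|pqe].
  apply: le_trans pqe; apply: sup_upper_bound; first exact: dist_has_sup.
  by right; exists n.
by apply: ge_sup => [|_ [->//|[n npq <-]]]; [exists 0; left|exact: pqe].
Qed.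

Let dist_ge0 p q : 0 <= branches_dist p q.
Proof. by apply: sup_upper_bound; [exact: dist_has_sup|left]. Qed.

Let dist_ge p q n : sval p n <> sval q n -> n.+1%:R^-1 <= branches_dist p q.
Proof. by move=> npq; apply: (branches_dist_le p q (dist_ge0 p q)).1. Qed.

Let distxx p : branches_dist p p = 0.
Proof.
apply/eqP; rewrite eq_le dist_ge0 andbT.
by apply/branches_dist_le => // n /(_ erefl).
Qed.

Let dist_positivity p q : branches_dist p q = 0 -> p = q.
Proof.
move=> pq0; apply: eq_sig_hprop => [? ? ?|]; first exact: Prop_irrelevance.
apply/funext => n; apply: contrapT => npq.
have /branches_dist_le : branches_dist p q <= 0 by rewrite pq0.
by move=> /(_ (lexx _) _ npq); rewrite leNgt invr_gt0 ltr0n.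
Qed.

Let dist_sym p q : branches_dist p q = branches_dist q p.
Proof.
congr (sup (_ |` _ @` _)); apply/funext => n.
by apply/propext; split => /nesym.
Qed.

Let dist_triangle q p r :
  branches_dist p r <= branches_dist p q + branches_dist q r.
Proof.
apply/branches_dist_le => [|n npr]; first by rewrite addr_ge0.
have [pq|npq] := pselect (sval p n = sval q n).
  apply: (@le_trans _ _ (branches_dist q r)); last by rewrite lerDr.
  by apply: dist_ge => qr; apply: npr; rewrite pq.
apply: (@le_trans _ _ (branches_dist p q)); last by rewrite lerDl.
exact: dist_ge.
Qed.

HB.instance Definition _ := @isMetric.Build R P
  branches_dist distxx dist_positivity dist_sym dist_triangle.

Lemma branches_mdist_lt p q n :
  mdist p q < n.+1%:R^-1 -> forall i, (i <= n)%N -> sval p i = sval q i.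
Proof.
move=> pq i iN; apply: contrapT => npq; move: pq; apply/negP; rewrite -leNgt.
apply: (@le_trans _ _ i.+1%:R^-1).
  by rewrite lef_pV2 ?posrE ?ltr0n// ler_nat.
exact: dist_ge.
Qed.

Lemma branches_mdist_le p q n :
  (forall i, (i < n)%N -> sval p i = sval q i) -> mdist p q <= n.+1%:R^-1.
Proof.
move=> pq; apply/branches_dist_le => [|i npq]; first by rewrite invr_ge0.
by rewrite lef_pV2 ?posrE ?ltr0n// ler_nat ltnS leqNgt; apply/negP => /pq.
Qed.

(** A countable dense set is obtained by choosing one member of [C] above each finite word that some
    member extends. *)
Lemma separable_branches : separable P.
Proof.
pose ext (w : seq T) p :=
  forall i, (i < size w)%N -> sval p i = nth (sval p i) w i.
pose D w : set P :=
  if pselect (exists p, ext w p) is left e then [set sval (cid e)] else set0.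
exists (\bigcup_w D w).
  apply: bigcup_countable => [|w _]; first exact: countableP.
  by rewrite /D; case: pselect => // e; exact: countable1.
move=> O [p Op] oO.
have /nbhs_ballP[e /= e0 eO] : nbhs p O by exact: open_nbhs_nbhs.
have [n ne] := ltr_add_invr e0; rewrite add0r in ne.
pose w := mkseq (sval p) n.
have ew : exists q, ext w q.
  by exists p => i; rewrite size_mkseq => ltin; rewrite nth_mkseq.
exists (sval (cid ew)); split; last first.
  exists w => //; rewrite /D; case: pselect => // e'.
  by rewrite (Prop_irrelevance e' ew).
apply: eO; rewrite ballEmdist /=; apply: le_lt_trans ne.
apply: branches_mdist_le => i ltin; case: cid => q /= /(_ i).
by rewrite size_mkseq => /(_ ltin); rewrite nth_mkseq.
Qed.

(** Each coordinate of a Cauchy sequence is eventually constant. The sequence [l] of eventual values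
    shares each initial segment with some [u (N n)], so it lies in [C]. *)
Lemma complete_branches :
  branch_closed C ->
  complete_metric (@mdist R P).
Proof.
move=> clC u cu.
have /choice[N NP] n : exists N, forall m, (N <= m)%N ->
    forall i, (i <= n)%N -> sval (u m) i = sval (u N) i.
  have [|[A B] /= [[a _ aA] [b _ bB]] AB] := cu n.+1%:R^-1.
    by rewrite invr_gt0.
  exists (maxn a b) => m; rewrite geq_max => /andP[am bm].
  apply: branches_mdist_lt; apply: (AB (m, maxn a b)); split => /=.
    exact: aA.
  by apply: bB; rewrite /= leq_maxr.
pose l i := sval (u (N i)) i.
have lE n i m : (i <= n)%N -> (N n <= m)%N -> l i = sval (u m) i.
  move=> ltin Nm; rewrite (NP n)// -(NP n (maxn (N i) (N n)))// ?leq_maxr//.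
  by rewrite (NP i)// leq_maxl.
have Cl : C l.
  apply: clC => n; exists (sval (u (N n))); first exact: (svalP (u (N n))).
  by move=> i /ltnW ltin; rewrite (lE n i (N n)).
exists (exist _ l Cl); apply/metricType_numDomainType.cvgrPdist_lt => e e0.
have [n ne] := ltr_add_invr e0; rewrite add0r in ne.
exists (N n) => // m /= Nm; apply: le_lt_trans ne.
by apply: branches_mdist_le => i /ltnW ltin; rewrite /= (lE n i m).
Qed.

Lemma polish_branches :
  branch_closed C ->
  polish R P.
Proof.
move=> clC; split; first exact: separable_branches.
exists (@mdist R P); last exact: complete_branches.
split.
- by move=> p q; split => [/mdist_positivity|->]//; rewrite mdistxx.
- exact: metric_sym.
- by move=> p q r; exact: metric_triangle.
- by move=> p; rewrite -metricType_numDomainType.filter_from_mdist_nbhs.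
Qed.

End branches.

(* [C] is closed for the product of the discrete topologies and [f] is
   continuous on it. *)
Lemma analytic_branches (R : realType) (X : metricType R) (T : countType)
    (C : set (nat -> T)) (f : (nat -> T) -> X) :
  branch_closed C ->
  (forall p e, C p -> 0 < e -> exists n, forall q, C q ->
    (forall i, (i <= n)%N -> p i = q i) -> mdist (f p) (f q) < e) ->
  analytic R (f @` C).
Proof.
move=> clC cf; right; exists (branches R C); split; first exact: polish_branches.
exists (fun p => f (sval p)) => [p|].
  apply/(metricType_numDomainType.cvgrPdist_lt (FF := nbhs_filter p)) => e e0.
  have [n nP] := cf _ _ (svalP p) e0.
  apply/nbhs_ballP; exists n.+1%:R^-1 => [|q]; first by rewrite /= invr_gt0.
  rewrite ballEmdist /= => pq; apply: nP; first exact: svalP.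
  exact: branches_mdist_lt.
apply/seteqP; split => [_ [p _ <-]|_ [p Cp <-]].
  by exists (sval p) => //; exact: svalP.
by exists (exist _ p Cp).
Qed.

(** * Moduli of contractivity *)

Section contractive_systems.
Context {R : realType} {X : metricType R}.
Context (cX : compact [set: X]).
Local Notation rad n := (n.+1%:R^-1 : R).

Definition contractive (s : X -> X) :=
  forall x y, x <> y -> mdist (s x) (s y) < mdist x y.

Let rad_gt0 n : 0 < rad n. Proof. by rewrite invr_gt0. Qed.

Let rad_le m n : (m <= n)%N -> rad n <= rad m.
Proof. by move=> mn; rewrite lef_pV2 ?posrE ?ltr0n// ler_nat. Qed.

Let exists_rad_lt (e : R) : 0 < e -> exists n, rad n < e.
Proof. by move=> /ltr_add_invr[n]; rewrite add0r; exists n. Qed.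

Lemma contractive_nonexpansive s x y :
  contractive s -> mdist (s x) (s y) <= mdist x y.
Proof.
by move=> cs; have [->|/cs/ltW//] := pselect (x = y); rewrite !mdistxx.
Qed.

(** If every [m] failed, the nested closed sets [E m] of pairs violating the bound would have a
    common point: two distinct points whose distance [s] does not decrease. *)
Lemma contractive_modulus s (r : R) : contractive s -> 0 < r ->
  exists m, forall x y, r <= mdist x y ->
    mdist (s x) (s y) <= mdist x y - rad m.
Proof.
move=> cs r0.
have ss : continuous s.
  by apply: nonexpansive_continuous => x y; exact: contractive_nonexpansive.
(* The first condition says [r <= mdist z.1 z.2], written with a zero distance on the left to fit
   [closed_mdist_le]. *)
pose E m := [set z : X * X | mdist z.1 z.1 <= mdist z.1 z.2 + - r] `&`
  [set z : X * X | mdist z.1 z.2 <= mdist (s z.1) (s z.2) + rad m].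
have c1 : continuous (fst : X * X -> X) by move=> z; exact: cvg_fst.
have c2 : continuous (snd : X * X -> X) by move=> z; exact: cvg_snd.
have cs1 : continuous (s \o fst : X * X -> X).
  by move=> z; apply: continuous_comp; [exact: c1|exact: ss].
have cs2 : continuous (s \o snd : X * X -> X).
  by move=> z; apply: continuous_comp; [exact: c2|exact: ss].
have cXX : compact [set: X * X] by rewrite -setXTT; exact: compact_setX.
apply: contrapT => nm.
have [|m|m|[x y] Exy] := nested_closed_meet (E := E) cXX.
- by move=> m; apply: closedI; exact: closed_mdist_le.
- apply: contrapT => E0; apply: nm; exists m => x y rxy.
  rewrite leNgt; apply/negP => xy; apply: E0; exists (x, y); split => /=.
    by rewrite mdistxx subr_ge0.
  by rewrite -lerBlDr ltW.
- move=> z [z1 z2]; split=> //; apply: le_trans z2 _.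
  by rewrite lerD2l rad_le.
have [/= rxy _] := Exy 0%N I; move: rxy; rewrite mdistxx subr_ge0 => rxy.
have /cs : x <> y by move=> xy; move: rxy; rewrite xy mdistxx leNgt r0.
rewrite -subr_gt0 => /exists_rad_lt[m]; rewrite ltrBrDl => rm.
have [_ /=] := Exy m I.
by rewrite leNgt rm.
Qed.

Lemma contractive_system_modulus k (s : nat -> X -> X) (r : R) :
  (forall i, (i <= k)%N -> contractive (s i)) -> 0 < r ->
  exists m, forall i x y, (i <= k)%N -> r <= mdist x y ->
    mdist (s i x) (s i y) <= mdist x y - rad m.
Proof.
move=> cs r0.
have /choice[m mP] i : exists m, (i <= k)%N -> forall x y, r <= mdist x y ->
    mdist (s i x) (s i y) <= mdist x y - rad m.
  have [ik|_] := leqP i k; last by exists 0%N.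
  by have [m mP] := contractive_modulus (cs i ik) r0; exists m.
exists (\max_(i < k.+1) m i)%N => i x y ik rxy.
apply: le_trans (mP i ik x y rxy) _; rewrite lerD2l lerN2 rad_le//.
exact: (leq_bigmax (Ordinal (ik : (i < k.+1)%N))).
Qed.

(** * Codes of systems and continuity of the attractor *)

Context (x0 : X).

Definition net n : seq X := sval (cid (finite_net cX (rad_gt0 n))).

Lemma netP n x :
  exists2 j, (j < size (net n))%N & mdist x (nth x0 (net n) j) < rad n.
Proof.
rewrite /net; case: cid => s /= /(_ x)[y ys xy].
by exists (index y s); rewrite ?index_mem// nth_index.
Qed.

(* The [n]-th letter [(k, m, g)] of a code of [s 0, ..., s k] consists of a
   modulus of contractivity [rad m] at scale [rad n] and, for each [i], the list
   [g_i] of the indices of points of the [n]-th net close to the images by [s i]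
   of the points of that net. Only the component [k] of the letter [0] is used.
   The system is uncurried so that Tychonoff's theorem applies. *)
Definition letter : countType := (nat * nat * seq (seq nat))%type.

(** Nonstrict inequalities keep the conditions closed. Strict contractivity, not closed in general,
    is recovered from the moduli at all scales. *)
Definition stage k n (a : letter) : set {ptws nat * X -> X} :=
  [set s | forall i, (i <= k)%N ->
    [/\ forall x y, mdist (s (i, x)) (s (i, y)) <= mdist x y,
        forall x y, rad n <= mdist x y ->
          mdist (s (i, x)) (s (i, y)) <= mdist x y - rad a.1.2 &
        forall j, (j < size (net n))%N ->
          mdist (s (i, nth x0 (net n) j))
                (nth x0 (net n) (nth 0%N (nth [::] a.2 i) j)) <= rad n]].

Definition codes (p : nat -> letter) : set {ptws nat * X -> X} :=
  \bigcap_n stage (p 0%N).1.1 n (p n).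

Lemma closed_stage k n a : closed (stage k n a).
Proof.
have cproj z : continuous (fun s : {ptws nat * X -> X} => s z).
  exact: (@proj_continuous _ (fun _ : nat * X => X) z).
have ccst (x : X) : continuous (fun _ : {ptws nat * X -> X} => x).
  exact: cst_continuous.
move=> s cls i ik.
have cl (A : set {ptws nat * X -> X}) : closed A -> stage k n a `<=` A -> A s.
  by move=> cA sA; apply: cA; exact: closureS cls.
split=> [x y|x y rxy|j jn].
- rewrite -[leRHS]addr0;
  apply: (cl [set s | _ <= mdist x y + 0]) => [|t /(_ i ik)[]].
    by apply: closed_mdist_le;
      [exact: cproj|exact: cproj|exact: ccst|exact: ccst].
  by move=> + _ _; rewrite /= addr0.
- apply: (cl [set s | _ <= mdist x y - rad a.1.2]) => [|t /(_ i ik)[]].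
    by apply: closed_mdist_le;
      [exact: cproj|exact: cproj|exact: ccst|exact: ccst].
  by move=> _ + _; apply.
- rewrite -[leRHS]add0r -(mdistxx x0).
  apply: (cl [set s | _ <= mdist x0 x0 + rad n]) => [|t /(_ i ik)[]].
    by apply: closed_mdist_le;
      [exact: cproj|exact: ccst|exact: ccst|exact: ccst].
  by move=> _ _ /(_ j jn) /=; rewrite mdistxx add0r.
Qed.

(** The systems compatible with the first [n+1] letters of [p] form nested closed sets in a compact
    product. They are nonempty because a coded [q] shares these letters, letter [0] and hence [k]
    included. *)
Lemma branch_closed_codes : branch_closed [set p | codes p !=set0].
Proof.
move=> p pC.
pose k := (p 0%N).1.1.
pose E n : set {ptws nat * X -> X} := \bigcap_(m in `I_n.+1) stage k m (p m).
have cT : compact [set: {ptws nat * X -> X}].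
  rewrite (_ : setT = [set f | forall z, [set: X] (f z)]); last exact/seteqP.
  exact: (@tychonoff _ (fun _ : nat * X => X) (fun _ => setT)).
have [n|n|n|s Es] := nested_closed_meet (E := E) cT.
- by apply: closed_bigI => m _; exact: closed_stage.
- have [q [s sq] pq] := pC n.+1; exists s => m /= mn.
  by rewrite pq// /k pq//; exact: sq.
- by move=> s sE m /= mn; apply: sE; exact: ltnW.
by exists s => n _; exact: (Es n I n (ltnSn n)).
Qed.

(** With [y] a net point near [x], equal letters give the same approximate value [c] of both maps at
    [y]. The path from [s x] through [s y], [c] and [t y] to [t x] has four steps of length at most
    [rad N]. *)
Lemma codes_close p q s t N i x :
  codes p s -> codes q t -> p 0%N = q 0%N -> p N = q N ->
  (i <= (p 0%N).1.1)%N -> mdist (s (i, x)) (t (i, x)) <= 4 * rad N.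
Proof.
move=> sp tq pq0 pqN ik.
have [s1 _ s3] := sp N I i ik.
have ikq : (i <= (q 0%N).1.1)%N by rewrite -pq0.
have [t1 _ t3] := tq N I i ikq.
have [j jN] := netP N x; set y := nth x0 _ _ => xy.
have := s3 j jN; have := t3 j jN; rewrite -pqN -/y.
set c := nth x0 _ _ => tc sc.
have := metric_triangle (s (i, x)) (s (i, y)) (t (i, x)).
have := metric_triangle (s (i, y)) c (t (i, x)).
have := metric_triangle c (t (i, y)) (t (i, x)).
have := s1 x y; have := t1 y x.
rewrite (metric_sym y x) (metric_sym c (t (i, y))).
move: xy tc sc; move: (rad N) => e; lra.
Qed.

(** Choosing [n] large and then [N] large gives uniqueness of the attractor when [p] and [q] are
    equal, and continuity in general. *)
Lemma mdist_coded p q s t n N (A B : hyperspace X) :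
  codes p s -> codes q t -> p 0%N = q 0%N -> p N = q N ->
  4 * rad N < rad (p n).1.2 ->
  (A : set X) = union_image (p 0%N).1.1 (fun i x => s (i, x)) A ->
  (B : set X) = union_image (q 0%N).1.1 (fun i x => t (i, x)) B ->
  mdist A B <= rad n + 4 * rad N.
Proof.
move=> sp tq pq0 pqN Nn As; rewrite -pq0 => Bt.
apply: (mdist_invariant _ _ _ Nn As Bt).
- by move=> i x y ik; have [/(_ x y)] := sp 0%N I i ik.
- by move=> i x y ik; have [_ /(_ x y)] := sp n I i ik.
- by move=> i x ik; exact: codes_close sp tq pq0 pqN ik.
Qed.

Lemma exists_code k s : (forall i, (i <= k)%N -> contractive (s i)) ->
  exists2 p, (p 0%N).1.1 = k & codes p (fun z => s z.1 z.2).
Proof.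
move=> cs.
have /choice[m mP] n := contractive_system_modulus cs (rad_gt0 n).
have /choice[c cP] (z : nat * X) :
    exists j, mdist z.2 (nth x0 (net z.1) j) <= rad z.1.
  by have [j _ /ltW] := netP z.1 z.2; exists j.
pose g n := mkseq (fun i =>
  mkseq (fun j => c (n, s i (nth x0 (net n) j))) (size (net n))) k.+1.
exists (fun n => (k, m n, g n)) => // n _ i ik; split=> /= [x y|x y|j jn].
- exact/contractive_nonexpansive/cs.
- exact: mP.
- by rewrite nth_mkseq// nth_mkseq//; exact: (cP (n, _)).
Qed.

(** Distinct points are at distance at least [rad n] for some [n], and the modulus at that scale is
    positive. *)
Lemma codes_contractive p s i :
  codes p s -> (i <= (p 0%N).1.1)%N -> contractive (fun x => s (i, x)).
Proof.
move=> sp ik x y /eqP; rewrite -mdist_gt0 => /exists_rad_lt[n /ltW nxy].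
have [_ /(_ x y nxy) + _] := sp n I i ik; move/le_lt_trans; apply.
by rewrite ltrBlDr ltrDl.
Qed.


Lemma analytic_contractive_attractors : analytic R
  [set A : hyperspace X | exists2 S : set (X -> X),
    finite_set S /\ (forall s, S s -> contractive s) &
    (A : set X) = \bigcup_(s in S) s @` A].
Proof.
have X0 : [set: X] !=set0 by exists x0.
pose attracts p (A : hyperspace X) := exists2 s, codes p s &
  (A : set X) = union_image (p 0%N).1.1 (fun i x => s (i, x)) A.
have /choice[f fP] p : exists A, codes p !=set0 -> attracts p A.
  have [[s sp]|np] := pselect (codes p !=set0); last first.
    (* A sequence coding no system gets a default value, an invariant set of the identity. *)
    have [|A _] := @exists_invariant R X 0 (fun _ => id) cX X0 _.
      by move=> i x y _.
    by exists A => /np.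
  have [i x y ik|A As] :=
      @exists_invariant _ _ (p 0%N).1.1 (fun i x => s (i, x)) cX X0 _.
    by have [/(_ x y)] := sp 0%N I i ik.
  by exists A => _; exists s.
have attracts_close p e : 0 < e -> exists n, forall q A B,
    (forall i, (i <= n)%N -> p i = q i) ->
    attracts p A -> attracts q B -> mdist A B < e.
  move=> e0.
  have [n ne] : exists n, rad n < e / 2.
    by apply: exists_rad_lt; rewrite divr_gt0.
  (* The modulus is read off [p] alone, so [N] does not depend on [q]. The bound on [rad N] makes
     [4 * rad N] smaller than both the modulus and [e / 2]. *)
  have [N] : exists N, rad N < Num.min (rad (p n).1.2) (e / 2) / 4.
    by apply: exists_rad_lt; rewrite divr_gt0// lt_min rad_gt0 divr_gt0.
  rewrite ltr_pdivlMr// lt_min mulrC => /andP[Nm Ne].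
  exists N => q A B pq [s sp As] [t tq Bt].
  apply: le_lt_trans (mdist_coded sp tq (pq _ _) (pq _ _) Nm As Bt) _ => //.
  by rewrite (splitr e) ltrD.
rewrite (_ : [set _ | _] = f @` [set p | codes p !=set0]).
  apply: analytic_branches; first exact: branch_closed_codes.
  move=> p e Cp e0; have [n nP] := attracts_close p e e0.
  by exists n => q Cq pq; apply: nP pq _ _; exact: fP.
apply/seteqP; split => [A [S [finS cS] AS]|_ [p Cp <-]]; last first.
  have [s sp As] := fP p Cp.
  exists ((fun i x => s (i, x)) @` `I_(p 0%N).1.1.+1).
    split=> [|_ [i ik <-]]; first exact: finite_image.
    exact: codes_contractive sp ik.
  by rewrite bigcup_image.
(* Since [A] is nonempty, so is [S]: a member [s0] serves as default for [nth], and the indices up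
   to [(size l).-1] enumerate [S]. *)
have [a Aa] := hyperset_nonempty A.
move: (Aa); rewrite {1}AS => -[s0 Ss0 _].
have [l Sl] := (finite_seqP S).1 finS.
pose s i := nth s0 l i.
have l0 : (0 < size l)%N by case: l Sl Ss0 {s} => // ->.
have sS i : (i <= (size l).-1)%N -> S (s i).
  by rewrite -ltnS prednK// => il; rewrite Sl /=; exact: mem_nth.
have [p pk sp] := exists_code (fun i ik => cS _ (sS i ik)).
have Cp : codes p !=set0 by eexists; exact: sp.
have pA : attracts p A.
  eexists; first exact: sp.
  rewrite pk {1}AS.
  apply/seteqP; split => [x [t + [y Ay <-]]|x [i ik [y Ay <-]]].
    rewrite Sl /= => tl; exists (index t l) => /=.
      by rewrite prednK ?index_mem.
    by exists y => //; rewrite /s nth_index.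
  by exists (s i); [exact: sS|exists y].
(* Both [f p] and [A] are attractors for the code [p], so [attracts_close] with [q] equal to [p]
   puts them at distance below every positive [e]. *)
exists p => //; apply/mdist_positivity/eqP; rewrite eq_le mdist_ge0 andbT.
apply/ler_addgt0Pl => e /(attracts_close p)[n nP]; rewrite addr0 ltW//.
by apply: nP => //; exact: fP.
Qed.

End contractive_systems.

(** * The unit interval *)

(** Compactness of the real segment is pulled back along the inclusion [v]: a cluster point of the
    image filter lies in the segment, and balls of the subspace are traces of real balls. *)
Lemma compact_unit_interval (R : realType) :
  compact [set: unit_interval_metric R].
Proof.
move=> F FF _; pose v (x : unit_interval R) : R := \val x.
have [|p [Ip clp]] := @segment_compact R 0 1 (v @ F) _.
  by apply: (@filterE _ F) => x; exact: set_mem (valP x).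
exists (exist _ p (mem_set Ip)); split => // B C FB /nbhs_ballP[e /= e0 eC].
have [||_ [[x Bx <-] px]] := clp (v @` B) (ball p e); last 1 first.
- exists x; split => //; apply: eC.
  by rewrite ballEmdist /= unit_interval_mdistE.
- by apply: (@filterS _ F _ B _ _ FB) => x Bx; exists x.
- exact: nbhsx_ballx.
Qed.

Theorem theorem3p1 (R : realType) : analytic R (wIFS1 R).
Proof.
have I0 : 0 \in unit_interval R.
  by rewrite inE /unit_interval /= in_itv /= lexx ler01.
have := analytic_contractive_attractors (@compact_unit_interval R)
  (exist _ 0 I0).
(* [contractive] and [weak_contraction] differ only in how the distance is written. *)
congr analytic; apply/seteqP; split => A [S [finS cS] AS]; exists S => //;
  split => // s Ss x y xy.
  by rewrite -!unit_interval_mdistE; exact: cS.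
by rewrite !unit_interval_mdistE; exact: cS.
Qed.
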